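(* Let $Q=\mathrm{Dih}(m,G,\alpha)$ be a finite dihedral-like automorphic loop such that either $\alpha\neq 1$ or $\exp(G)>2$. Then $\mathrm{Aut}(Q)$ is isomorphic to $(\mathrm{Par}(m,G,\alpha),\circ)$, where $$(\gamma_0,z_0,c_0,h_0)\circ(\gamma_1,z_1,c_1,h_1)=(\gamma_0\gamma_1,\ z_0\gamma_1+z_1,\ c_0c_1+z_0h_1,\ h_0+\gamma_0h_1).$$
   Context: Let $m\ge 2$ be an even integer, $G$ an abelian group (written additively) and $\alpha\in\mathrm{Aut}(G)$, where $\alpha^2=1$ is required if $m>2$ (no condition on $\alpha$ if $m=2$). The dihedral-like automorphic loop $\mathrm{Dih}(m,G,\alpha)$ is the loop defined on $\mathbb{Z}_m\times G$ by $(i,u)(j,v)=(i+j,(s_ju+v)\alpha^{ij})$, where $s_j=(-1)^j$, $i,j\in\{0,\dots,m-1\}$, the first coordinate is added modulo $m$, and the exponent $ij$ is the integer product, not reduced modulo $m$. Its identity element is $(0,0)$. Maps (automorphisms, homomorphisms) are written to the right of their arguments and are composed from left to right; in particular the product of automorphisms in $\mathrm{Aut}(Q)$ and $\mathrm{Aut}(G)$ is left-to-right composition. The condition $\exp(G)>2$ means that $2u\ne0$ for some $u\in G$. $\mathrm{Par}(m,G,\alpha)$ is the set of all quadruples $(\gamma,z,c,h)$ such that: $\gamma\in\mathrm{Aut}(G)$ satisfies $\gamma^{-1}\alpha\gamma=\alpha$; $z\in G$; $c\in\mathbb{Z}_m$ is odd and $\gcd(c,m/2)=1$; $h$ is a homomorphism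 from $G$ to the subgroup $\langle m/2\rangle=\{0,m/2\}$ of $\mathbb{Z}_m$ that is trivial if $m/2$ is odd, and that satisfies $\alpha h=h$ (i.e. $(u\alpha)h=uh$ for all $u\in G$) if $m/2$ is even. In the formula for $\circ$, the third coordinate is computed in $\mathbb{Z}_m$, and $h_0+\gamma_0h_1$ is the map $u\mapsto uh_0+(u\gamma_0)h_1$. *)

(* Defs.v *)
From mathcomp Require Import all_boot all_order all_algebra all_fingroup.

Set Implicit Arguments.
Unset Strict Implicit.
Unset Printing Implicit Defensive.

Import GRing.Theory.
Local Open Scope ring_scope.

(* Maps act on the right in the mathematics: u gamma is written gamma u here,
   and the product of {perm T} is already left-to-right composition
   (permM : (s * t)%g x = t (s x)). *)

Definition loop_Aut (T : finType) (op : T -> T -> T) : {set {perm T}} :=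
  [set f : {perm T} | [forall x, forall y, f (op x y) == op (f x) (f y)]].

Section DihedralLike.
Variables (m : nat) (G : finZmodType).

(* 'Z_m is Z/m only for 1 < m.  Elements of 'Z_m coerce to their representative
   in {0, .., m-1}, so i * j in the exponent is the unreduced product in nat. *)
Definition dih_mul (alpha : {perm G}) (x y : 'Z_m * G) : 'Z_m * G :=
  let: (i, u) := x in let: (j, v) := y in
  (i + j, (alpha ^+ (i * j)%N)%g (u *~ ((-1) ^+ j) + v)).

Definition half : 'Z_m := (m./2)%:R.

(* Quadruples (gamma, z, c, h). *)
Definition quad : finType := ({perm G} * G * 'Z_m * {ffun G -> 'Z_m})%type.

Definition Par (alpha : {perm G}) : {set quad} :=
  [set p : quad | let: (gamma, z, c, h) := p in
    [&& gamma \in Aut [set: G],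
        (gamma^-1 * alpha * gamma == alpha)%g,
        odd c && coprime c m./2,
        [forall u, forall v, h (u + v) == h u + h v],
        [forall u, h u \in [:: 0; half]] &
        if odd m./2 then [forall u, h u == 0]
        else [forall u, h (alpha u) == h u]]].

Definition par_mul (p0 p1 : quad) : quad :=
  let: (gamma0, z0, c0, h0) := p0 in
  let: (gamma1, z1, c1, h1) := p1 in
  ((gamma0 * gamma1)%g, gamma1 z0 + z1, c0 * c1 + h1 z0,
   [ffun u => h0 u + h1 (gamma0 u)]).

End DihedralLike.

(* The sets S and S' are closed under op and op', and f restricts to a bijection
   of S onto S' carrying op to op'. *)
Definition isomorphism (T T' : finType) (S : {set T}) (op : T -> T -> T)
    (S' : {set T'}) (op' : T' -> T' -> T') (f : T -> T') : Prop :=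
  [/\ {in S &, forall x y, op x y \in S},
      {in S' &, forall x y, op' x y \in S'},
      {in S &, injective f},
      f @: S = S' &
      {in S &, forall x y, f (op x y) = op' (f x) (f y)}].

(* Main.v *)
Require Import Defs.
From mathcomp Require Import all_boot all_order all_algebra all_fingroup.
From mathcomp Require Import zify.

(** Since (i, u) = (i, 0)(0, u), an automorphism f is determined by
    f(1, 0) = (c, z) and by the maps h, gamma with f(0, u) = (h u, gamma u).
    The relation (1, 0)(0, u) = ((0, u)(1, 0))((0, u)(0, u)) forces 2 h u = 0, and
    h u is even: when alpha <> 1 because (0, u) lies in the middle nucleus, all of
    whose elements have an even first coordinate; when exp(G) > 2 because an
    element (i, w) with i odd and 2 i = 0 has order 2, so 2 u = 0 whenever h u is
    odd, which cannot hold for both v and v + u once 2 v <> 0.  As 2 h u = 0 and h u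
    is even, (i c + h u)^2 = i^2 c^2, and surjectivity makes c a unit of Z_m.  Then
    f(h w, 0) = (h w, 0), so gamma is injective, and f is the map
    (i, u) |-> (i c + h u, [i odd] z + gamma u). *)

Set Implicit Arguments.
Unset Strict Implicit.
Unset Printing Implicit Defensive.

Import GRing.Theory.
Local Open Scope ring_scope.

Lemma AutT_addP (G : finZmodType) (a : {perm G}) :
  reflect {morph a : u v / u + v} (a \in Aut [set: G]).
Proof.
rewrite inE; apply: (iffP andP) => [[_ /morphicP aD] u v|aD].
  by have := aD u v (in_setT u) (in_setT v); rewrite !FinRing.zmodMgE.
split; first by apply/subsetP => u _; rewrite inE.
by apply/morphicP => u v _ _; rewrite !FinRing.zmodMgE.
Qed.

(** * Parity and elements of order two in Z_m for even m *)

Section EvenModulus.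
Variable m : nat.
Hypotheses (m_gt1 : (1 < m)%N) (m_even : ~~ odd m).
Implicit Types i j : 'Z_m.

(** Sums and products in ['Z_m] reduce modulo [(Zp_trunc m).+2], which is m as 1 < m; reduction by
    an even number keeps parity. *)
Let odd_Zp_mod k : odd (k %% (Zp_trunc m).+2) = odd k.
Proof. by rewrite odd_mod // Zp_cast //; apply: negbTE. Qed.

Lemma odd_ZpD i j : odd (i + j)%R = odd i (+) odd j.
Proof. by rewrite odd_Zp_mod oddD. Qed.

Lemma odd_ZpM i j : odd (i * j)%R = odd i && odd j.
Proof. by rewrite odd_Zp_mod oddM. Qed.

Lemma odd_Zp_nat k : odd (k%:R : 'Z_m) = odd k.
Proof. by rewrite val_Zp_nat // odd_mod //; apply: negbTE. Qed.

Lemma odd_half : odd (Defs.half m) = odd m./2.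
Proof. by rewrite /Defs.half val_Zp_nat // odd_mod //; apply: negbTE. Qed.

Lemma Zp_double_eq0 i : (i + i == 0) = (i \in [:: 0; Defs.half m]).
Proof.
have lt_im : (i < m)%N by rewrite -{2}(Zp_cast m_gt1).
have eq_m : m = (m./2).*2 by rewrite even_halfK.
have lt_hm : (m./2 < m)%N by lia.
have -> : (i + i == 0) = ((i + i) %% m == 0)%N.
  by rewrite -val_eqE /=; congr (_ %% _ == _)%N; apply: Zp_cast.
rewrite !inE -!val_eqE /= /Defs.half val_Zp_nat // (modn_small lt_hm).
(* The natural number i + i is below 2m, so reducing it subtracts m at most once. *)
have [lt_ih|le_hi] := ltnP (i + i)%N m; first by rewrite modn_small //; lia.
by rewrite -(subnK le_hi) modnDr modn_small; lia.
Qed.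

Lemma Zp_mul_odd i j : i + i = 0 -> i * j = i *+ odd j.
Proof.
move=> ii0; rewrite -{1}[j]natr_Zp mulr_natr -{1}(odd_double_half j).
by rewrite mulrnDr -muln2 mulnC mulrnA mulr2n ii0 mul0rn addr0.
Qed.

(** As m = 2(m/2), coprimality to m splits in two; the condition on c in [Par] thus says that c is a
    unit. *)
Lemma unit_ZpE i : (i \is a GRing.unit) = odd i && coprime i m./2.
Proof.
rewrite -{1}[i]natr_Zp unitZpE //; move: (nat_of_ord i) => k.
rewrite -{1}(even_halfK m_even) -mul2n coprimeMl coprime2n.
by rewrite [coprime k _]coprime_sym.
Qed.

End EvenModulus.

(** * The loop operation in terms of parities *)

Section DihedralLike.
Variables (m : nat) (G : finZmodType) (alpha : {perm G}).
Hypotheses (m_gt1 : (1 < m)%N) (m_even : ~~ odd m).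
Hypotheses (alphaD : {morph alpha : u v / u + v}).
Hypotheses (alpha2 : (2 < m)%N -> (alpha ^+ 2 = 1)%g).
Implicit Types (i j : 'Z_m) (u v : G) (p q : quad m G).

(** Only the parity of the exponent ij matters: for m > 2 because alpha has square 1, for m = 2
    because the unreduced ij is already 0 or 1. *)
Lemma dih_mulE i u j v : dih_mul alpha (i, u) (j, v) =
  (i + j, (if odd i && odd j then alpha else 1%g)
            ((if odd j then - u else u) + v)).
Proof.
rewrite /dih_mul; congr pair.
have -> : u *~ (-1) ^+ j = if odd j then - u else u.
  by rewrite -signr_odd; case: (odd j); rewrite ?expr1 ?expr0.
have -> // : (alpha ^+ (i * j)%N)%g = if odd i && odd j then alpha else 1%g.
rewrite -oddM; have [m_gt2|m_le2] := ltnP 2 m.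
  rewrite -[in LHS](odd_double_half (i * j)) -mul2n expgnDr expgM alpha2 //.
  by rewrite expg1n mulg1; case: odd.
have lt_m (k : 'Z_m) : (k < 2)%N.
  by apply: leq_trans m_le2; rewrite -{2}(Zp_cast m_gt1).
by move: (lt_m i) (lt_m j); case: (val i) (val j) => [|[|//]] [|[|//]].
Qed.

Lemma dih_mul_fst (x y : 'Z_m * G) : (dih_mul alpha x y).1 = x.1 + y.1.
Proof. by case: x y => [i u] [j v]. Qed.

Lemma dih_mul_pair i u : dih_mul alpha (i, 0) (0, u) = (i, u).
Proof. by rewrite dih_mulE andbF perm1 addr0 add0r. Qed.

Let alpha0 : alpha 0 = 0.
Proof. by apply: (addrI (alpha 0)); rewrite -alphaD !addr0. Qed.

Lemma dih_mul_succ i : dih_mul alpha (i, 0) (1, 0) = (i + 1, 0).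
Proof. by rewrite dih_mulE /= oppr0 addr0; case: ifP; rewrite ?alpha0 ?perm1. Qed.

(** * From parameters to automorphisms *)

Definition aut_map p (x : 'Z_m * G) : 'Z_m * G :=
  let: (gamma, z, c, h) := p in
  (x.1 * c + h x.2, z *+ odd x.1 + gamma x.2).

(** This removes the case split on m/2. Evenness of h u excludes the value m/2 exactly when m/2 is
    odd, and then h = 0 is invariant under alpha anyway. *)
Lemma ParP (gamma : {perm G}) z (c : 'Z_m) (h : {ffun G -> 'Z_m}) :
  reflect [/\ {morph gamma : u v / u + v},
              forall u, gamma (alpha u) = alpha (gamma u),
              odd c && coprime c m./2, {morph h : u v / u + v} &
              forall u, [/\ h u + h u = 0, ~~ odd (h u) & h (alpha u) = h u]]
          ((gamma, z, c, h) \in Par m alpha).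
Proof.
have oddh := odd_half m_gt1 m_even; have dbl := Zp_double_eq0 m_gt1 m_even.
rewrite inE; apply: (iffP and5P).
  case=> /AutT_addP gammaD /eqP comm odd_c /'forall_'forall_eqP hD.
  case/andP=> /forallP h_half htriv; split=> // u.
    by rewrite -{2}comm !permM permK.
  have /eqP hh : h u + h u == 0 by rewrite dbl.
  split=> //.
    move: htriv (h_half u); case: ifP => [_ /forallP/(_ u)/eqP-> //|even_m2 _].
    by rewrite !inE => /orP[] /eqP-> //; rewrite oddh even_m2.
  by move: htriv; case: ifP => _ /forallP htriv; rewrite ?(eqP (htriv _)).
case=> gammaD comm odd_c hD hP; split=> //.
- exact/AutT_addP.
- by apply/eqP/permP => u; rewrite !permM comm permKV.
- by apply/'forall_'forall_eqP.
have h_half u : h u \in [:: 0; Defs.half m].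
  by rewrite -dbl; case: (hP u) => ->.
apply/andP; split; first exact/forallP.
case: ifP => odd_m2; last by apply/forallP => u; case: (hP u) => _ _ ->.
apply/forallP => u; move: (h_half u); rewrite !inE => /orP[//|/eqP hu].
by case: (hP u); rewrite hu oddh odd_m2.
Qed.

(** The values at (1, 0) and (0, u) recover the parameters, once h 0 and gamma 0 are known to
    vanish. *)
Lemma aut_map_eq p q :
  aut_map p (0, 0) = (0, 0) -> aut_map p =1 aut_map q -> p = q.
Proof.
move: p q => [[[gamma z] c] h] [[[gamma' z'] c'] h'] p0 eqpq.
have := eqpq (0, 0); rewrite p0 => q0; move: p0 q0 (eqpq (1, 0)) => /=.
rewrite !mul0r !mul1r !mulr0n !mulr1n !add0r => -[-> ->] [<- <-].
rewrite !addr0 => -[-> ->].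
have eq_hg u : (h u, gamma u) = (h' u, gamma' u).
  by have := eqpq (0, u); rewrite /= !mul0r !mulr0n !add0r.
congr (_, _, _, _); first by apply/permP => u; case: (eq_hg u).
by apply/ffunP => u; case: (eq_hg u).
Qed.

Lemma aut_map0 p : p \in Par m alpha -> aut_map p (0, 0) = (0, 0).
Proof.
case: p => -[[gamma z] c] h /ParP[gammaD _ _ hD _] /=.
rewrite mul0r mulr0n !add0r; congr pair.
  by apply: (addrI (h 0)); rewrite -hD !addr0.
by apply: (addrI (gamma 0)); rewrite -gammaD !addr0.
Qed.

Lemma aut_map_inj p : p \in Par m alpha -> injective (aut_map p).
Proof.
case: p => -[[gamma z] c] h /ParP[_ _ /andP[odd_c co_c] _ hP] [i u] [j v] /=.
move=> eq_p; have /= eq1 := congr1 fst eq_p; have /= eq2 := congr1 snd eq_p.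
have eq_odd : odd i = odd j.
  have := congr1 (fun k : 'Z_m => odd k) eq1.
  have [_ /negbTE hu _] := hP u; have [_ /negbTE hv _] := hP v.
  by rewrite !odd_ZpD // !odd_ZpM // odd_c hu hv !andbT !addbF.
move: eq2; rewrite eq_odd => /addrI/perm_inj eq_uv.
move: eq1; rewrite eq_uv => /addIr/mulIr-> //.
by rewrite unit_ZpE ?odd_c.
Qed.

(** With c odd and h even-valued, first coordinates keep their parity, so the same signs and powers
    of alpha occur on both sides. Signs inside h are harmless since 2h = 0. *)
Lemma aut_map_morph p : p \in Par m alpha ->
  {morph aut_map p : x y / dih_mul alpha x y}.
Proof.
case: p => -[[gamma z] c] h /ParP[gammaD comm /andP[odd_c co_c] hD hP].
move=> [i u] [j v].
have h0 : h 0 = 0 by apply: (addrI (h 0)); rewrite -hD !addr0.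
have hN w : h (- w) = h w.
  have [hh _ _] := hP w.
  by apply: (addrI (h w)); rewrite hh -hD subrr.
have gamma0 : gamma 0 = 0 by apply: (addrI (gamma 0)); rewrite -gammaD !addr0.
have gammaN w : gamma (- w) = - gamma w.
  by apply: (addrI (gamma w)); rewrite -gammaD !subrr.
have odd_im k w : odd (k * c + h w)%R = odd k.
  have [_ /negbTE hw _] := hP w.
  by rewrite odd_ZpD // odd_ZpM // odd_c hw andbT addbF.
rewrite /aut_map !dih_mulE /= !odd_im odd_ZpD //; congr pair.
  have -> : h ((if odd i && odd j then alpha else 1%g)
      ((if odd j then - u else u) + v)) = h u + h v.
    have hA w : h ((if odd i && odd j then alpha else 1%g) w) = h w.
      by case: ifP => _; rewrite ?perm1 //; case: (hP w).
    by rewrite hA hD; case: ifP => _; rewrite ?hN.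
  by rewrite mulrDl addrACA.
case: (odd i); case: (odd j); rewrite /= ?perm1 ?comm ?gammaD ?gammaN ?add0r //.
- by rewrite opprD addrACA addNr add0r.
- by rewrite addrA.
- by rewrite addrCA.
Qed.

Lemma aut_map_mul p q : p \in Par m alpha -> q \in Par m alpha ->
  aut_map q \o aut_map p =1 aut_map (par_mul p q).
Proof.
move: p q => [[[gamma z] c] h] [[[gamma' z'] c'] h'].
move=> /ParP[gammaD comm /andP[odd_c co_c] hD hP].
move=> /ParP[gammaD' comm' /andP[odd_c' co_c'] hD' hP'] [i u].
rewrite /comp /aut_map /par_mul /fst /snd.
have [hh /negbTE odd_h _] := hP u; have [hz _ _] := hP' z.
rewrite odd_ZpD // odd_ZpM // odd_c odd_h andbT addbF ffunE mulrDl mulrDr.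
(* Here h u c' = h u because c' is odd, and i (h' z) is h' z or 0 by the parity of i; this produces
   the term h' z beside c c'. *)
rewrite (Zp_mul_odd c' hh) odd_c' mulr1n [i * h' z]mulrC (Zp_mul_odd i hz) mulrA.
rewrite permM.
case: (odd i); rewrite ?mulr1n ?mulr0n ?add0r ?gammaD' ?hD' ?addr0 ?addrA //.
by congr pair; [congr (_ + _); rewrite addrAC | rewrite [z' + _]addrC].
Qed.

(** * From automorphisms to parameters *)

Lemma mem_loop_AutP (s : {perm 'Z_m * G}) :
  reflect {morph s : x y / dih_mul alpha x y} (s \in loop_Aut (dih_mul alpha)).
Proof. by rewrite inE; apply: 'forall_'forall_eqP. Qed.

Lemma loop_Aut_aut_map (s : {perm 'Z_m * G}) :
    (alpha <> 1%g \/ exists u : G, u *+ 2 <> 0) ->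
    {morph s : x y / dih_mul alpha x y} ->
  exists2 p, p \in Par m alpha & s =1 aut_map p.
Proof.
move=> hQ sM.
have odd0 : odd (0 : 'Z_m)%R = false by [].
have odd1 : odd (1 : 'Z_m)%R = true by [].
have mulE0 (u v : G) : dih_mul alpha (0 : 'Z_m, u) (0, v) = (0, u + v).
  by rewrite dih_mulE addr0 perm1.
(* The image of the identity is idempotent, and (0, 0) is the only idempotent. *)
have s0 : s (0, 0) = (0, 0).
  have := sM (0, 0) (0, 0); rewrite mulE0 addr0.
  case: (s (0, 0)) => i u eq_s; have := congr1 fst eq_s.
  rewrite dih_mul_fst /= -[LHS]addr0 => /addrI i0.
  have := congr1 snd eq_s; rewrite -i0 mulE0 /= -[LHS]addr0 => /addrI u0.
  by rewrite -u0.
pose h u := (s (0, u)).1; pose g u := (s (0, u)).2.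
have sE u : s (0, u) = (h u, g u) by rewrite -surjective_pairing.
case s1: (s (1, 0)) => [c z].
have hD : {morph h : u v / u + v}.
  by move=> u v; rewrite /h -mulE0 sM dih_mul_fst.
have hh u : h u + h u = 0.
  have eq_u : dih_mul alpha (1 : 'Z_m, 0) (0, u) =
      dih_mul alpha (dih_mul alpha (0, u) (1, 0)) (dih_mul alpha (0, u) (0, u)).
    by rewrite !dih_mulE /= !perm1 !addr0 !add0r addrA addNr add0r.
  have := congr1 (fun x => (s x).1) eq_u; rewrite !sM !dih_mul_fst sE s1 /=.
  by rewrite addrC -[LHS]addr0 => /addrI.
have hN u : h (- u) = h u.
  have h0 : h 0 = 0 by rewrite /h s0.
  by apply: (addrI (h u)); rewrite hh -hD subrr.
have even_h u : odd (h u) = false.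
  case: hQ => [alpha_neq1|[v v2]]; apply/negP => odd_h.
    case: alpha_neq1; apply/permP => a; rewrite perm1.
    have nuc (x y : 'Z_m * G) : dih_mul alpha (dih_mul alpha x (0, u)) y =
        dih_mul alpha x (dih_mul alpha (0, u) y).
      case: x y => [i b] [k d]; rewrite (dih_mulE i b) (dih_mulE 0 u) !dih_mulE.
      rewrite !addr0 !add0r odd0 andbF /= !perm1.
      by case: (odd k); rewrite ?opprD addrA.
    (* The preimages make the images (0, a) and (1, 0). For h u odd, second coordinates read alpha
       (a - g u) = a + alpha (- g u), so alpha fixes every a. *)
    have := congr1 s (nuc (s^-1%g (0, a)) (s^-1%g (1, 0))).
    rewrite !sM !permKV sE (dih_mulE 0 a) (dih_mulE (h u) (g u)) !dih_mulE.
    rewrite add0r odd_ZpD // odd_h odd0 odd1 => /(congr1 snd) /=.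
    by rewrite !perm1 !addr0 opprD opprK alphaD => /addIr.
  have odd_double w : odd (h w) -> w + w = 0.
    move=> odd_hw; have := sM (0, w) (0, w).
    rewrite mulE0 sE dih_mulE odd_hw /= hh addNr alpha0 -s0.
    by move/perm_inj => /(congr1 snd).
  have odd_hv : odd (h (v + u)).
    rewrite hD odd_ZpD // odd_h addbT; apply/negP => /odd_double.
    by rewrite -mulr2n.
  apply: v2; move: (odd_double _ odd_hv).
  by rewrite addrACA (odd_double u odd_h) addr0 mulr2n.
have fstE i u : (s (i, u)).1 = i * c + h u.
  have fst_nat k : (s (k%:R, 0)).1 = k%:R * c.
    elim: k => [|k IHk]; first by rewrite mul0r s0.
    by rewrite -natr1 -dih_mul_succ sM dih_mul_fst IHk s1 mulrDl mul1r.
  by rewrite -dih_mul_pair sM dih_mul_fst -{1}[i]natr_Zp fst_nat natr_Zp.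
have [i [u icu]] : exists i u, i * c + h u = 1.
  by case s1V: (s^-1%g (1, 0)) => [i u]; exists i, u; rewrite -fstE -s1V permKV.
have unit_c : c \is a GRing.unit.
  (* The product is (1 - h u)(1 + h u) = 1, since (h u)^2 = 0 for h u even with 2 h u = 0. *)
  apply/unitrPr; exists (i * (1 + h u)); rewrite mulrA [c * i]mulrC.
  have -> : i * c = 1 - h u by rewrite -icu addrK.
  rewrite mulrDr mulr1 mulrBl mul1r (Zp_mul_odd _ (hh u)) // even_h mulr0n.
  by rewrite subr0 subrK.
have /andP[odd_c co_c] : odd c && coprime c m./2 by rewrite -unit_ZpE.
(* Multiplying on the right by (c, z), with c odd, turns second coordinate 0 into z and, at odd k, z
   into alpha (- z + z) = 0. *)
have s_nat k : s (k%:R, 0) = (k%:R * c, z *+ odd k).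
  elim: k => [|k IHk]; first by rewrite mul0r s0.
  rewrite -natr1 -dih_mul_succ sM IHk s1 dih_mulE odd_ZpM // odd_Zp_nat //.
  rewrite odd_c andbT mulrDl mul1r /=.
  by case: (odd k); rewrite ?mulr0n ?oppr0 ?add0r ?mulr1n ?addNr ?alpha0 ?perm1.
have s_cyc j : s (j, 0) = (j * c, z *+ odd j).
  by rewrite -{1}[j]natr_Zp s_nat natr_Zp.
have s_pair j w : s (j, w) = (j * c + h w, z *+ odd j + g w).
  by rewrite -dih_mul_pair sM s_cyc sE dih_mulE even_h andbF perm1.
have gD : {morph g : v w / v + w}.
  by move=> v w; rewrite {1}/g -mulE0 sM !sE dih_mulE !even_h /= perm1.
have g0 : g 0 = 0 by rewrite /g s0.
have gN w : g (- w) = - g w by apply: (addrI (g w)); rewrite -gD !subrr.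
have ginj : injective g.
  move=> v w eq_g; apply/eqP; rewrite -subr_eq0; apply/eqP.
  (* Both sides equal (h (v - w), 0), as c is odd. *)
  have : s (0, v - w) = s (h (v - w), 0).
    rewrite s_cyc sE gD gN eq_g subrr even_h mulr0n.
    by rewrite (Zp_mul_odd _ (hh _)) // odd_c mulr1n.
  by move/perm_inj => /(congr1 snd).
(* Both invariances come from the single product (1, -w)(1, 0) = (2, alpha w). *)
have comm w : h w = h (alpha w) /\ g (alpha w) = alpha (g w).
  have := sM (1, - w) (1, 0); rewrite dih_mulE odd1 /= opprK addr0.
  rewrite s1 !s_pair dih_mulE !odd_ZpD // odd_ZpM // odd_c even_h odd1 /=.
  rewrite mul1r mulr1n mulr0n add0r hN gN opprB addrNK mulrDl mul1r => eq_s.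
  split; last by have := congr1 snd eq_s.
  by have := congr1 fst eq_s; rewrite /= [RHS]addrAC => /addrI.
exists (perm ginj, z, c, finfun h).
  apply/ParP; split.
  - by move=> v w; rewrite !permE gD.
  - by move=> w; rewrite !permE; case: (comm w).
  - by rewrite odd_c.
  - by move=> v w; rewrite !ffunE hD.
  - by move=> w; rewrite !ffunE even_h; case: (comm w) => <-.
by case=> j w; rewrite s_pair /aut_map permE ffunE.
Qed.

End DihedralLike.

Theorem theorem5p3 (m : nat) (G : finZmodType) (alpha : {perm G})
  (hm : (2 <= m)%N) (hm_even : ~~ odd m)
  (halpha : alpha \in Aut [set: G])
  (halpha2 : (2 < m)%N -> (alpha ^+ 2 = 1)%g)
  (hQ : alpha <> 1%g \/ exists u : G, u *+ 2 <> 0) :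
  exists f : {perm 'Z_m * G} -> quad m G,
    isomorphism (loop_Aut (dih_mul alpha)) (fun s t => (s * t)%g)
                (Par m alpha) (@par_mul m G) f.
Proof.
have alphaD := AutT_addP _ halpha.
pose A := loop_Aut (@dih_mul m G alpha).
(* The default is never reached on [A], where a parameter always exists; [f_uniq] shows that the
   choice is forced. *)
pose f (s : {perm 'Z_m * G}) : quad m G :=
  odflt (1%g, 0, 0, [ffun=> 0])
    [pick p in Par m alpha | [forall x, s x == aut_map p x]].
have fP s : s \in A -> f s \in Par m alpha /\ s =1 aut_map (f s).
  move=> /mem_loop_AutP sM; rewrite /f.
  have [p /andP[p_par /'forall_eqP sp] //|no_p] := pickP.
  have [p p_par sp] := loop_Aut_aut_map hm hm_even alphaD halpha2 hQ sM.
  by case/andP: (no_p p); split=> //; apply/'forall_eqP.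
have f_uniq s p : s \in A -> p \in Par m alpha -> s =1 aut_map p -> f s = p.
  move=> /fP[fs_par sfs] p_par sp.
  by apply: (aut_map_eq (aut_map0 hm hm_even fs_par)) => x; rewrite -sfs.
have mulA : {in A &, forall s t, (s * t)%g \in A}.
  move=> s t /mem_loop_AutP sM /mem_loop_AutP tM; apply/mem_loop_AutP => x y.
  by rewrite !permM sM tM.
have realize p : p \in Par m alpha -> exists2 s, s \in A & f s = p.
  move=> p_par; pose s := perm (aut_map_inj hm hm_even p_par).
  have sA : s \in A.
    apply/mem_loop_AutP => x y; rewrite !permE.
    exact: (aut_map_morph hm hm_even halpha2 p_par).
  by exists s => //; apply: f_uniq => // x; rewrite permE.
have fM : {in A &, forall s t, f (s * t)%g = par_mul (f s) (f t)}.
  move=> s t sA tA; have [fs_par sfs] := fP s sA; have [ft_par tft] := fP t tA.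
  have [fst_par stfst] := fP _ (mulA s t sA tA).
  apply: (aut_map_eq (aut_map0 hm hm_even fst_par)) => x.
  by rewrite -stfst -(aut_map_mul hm hm_even fs_par ft_par) permM /= -sfs -tft.
exists f; split=> //.
(* Closure of [Par] is inherited from [A], every parameter being a value of [f]. *)
- move=> p q /realize[s sA <-] /realize[t tA <-].
  by rewrite -fM //; case: (fP _ (mulA s t sA tA)).
- move=> s t /fP[_ sfs] /fP[_ tft] eq_f; apply/permP => x.
  by rewrite sfs eq_f -tft.
- apply/setP => p; apply/imsetP/idP => [[s sA ->]|/realize[s sA <-]].
    by case: (fP s sA).
  by exists s.
Qed.
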